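(* Let $d\ge 2$, let $\Gamma=(V,\mathcal E)$ be a $\mathbb Z^d$-periodic graph, let $\Gamma_1$ be a fundamental domain of $\Gamma$, and let $H=\Delta+Q$ be the discrete Schrödinger operator on $\ell^2(V)$ with normalized Laplacian $\Delta$ and real periodic potential $Q$. Let $\nu=\#V_F$, $\nu_1=\#V_1$, $\nu_o=\#V_o$, let $\lambda_1^1\le\ldots\le\lambda_{\nu_1}^1$ and $\lambda_1^o\le\ldots\le\lambda_{\nu_o}^o$ be the eigenvalues, counted with multiplicity, of the Neumann operator $H_1$ and the Dirichlet operator $H_o$ on $\Gamma_1$, and let $q_1^\bullet\le\ldots\le q_\nu^\bullet$ be the values $Q(v_1),\ldots,Q(v_\nu)$ of $Q$ on $V_F=\{v_1,\ldots,v_\nu\}$ arranged in nondecreasing order. Then each band $\sigma_n(H)$ of $H$ satisfies $$\sigma_n(H)\subset\mathcal J_n\cap\mathcal K_n,\qquad n=1,\ldots,\nu,$$ where $$\mathcal J_n=\begin{cases}[\lambda_n^1,\lambda_n^o], & n=1,\ldots,\nu_o,\\ [\lambda_n^1,q_n^\bullet+1], & n=\nu_o+1,\ldots,\nu,\end{cases}$$ $$\mathcal K_n=\begin{cases}[q_n^\bullet-1,\lambda_{n+\nu_1-\nu}^1], & n=1,\ldots,\nu-\nu_o,\\ [\lambda_{n-\nu+\nu_o}^o,\,\lambda_{n+\nu_1-\nu}^1], & n=\nu-\nu_o+1,\ldots,\nu.\end{cases}$$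
   Context: **Periodic graphs.** $\Gamma=(V,\mathcal E)$ is a connected infinite graph embedded in $\mathbb R^d$, possibly with loops and multiple edges, with vertex set $V$ and set $\mathcal E$ of unoriented edges. The degree $\varkappa_v$ of $v\in V$ is the number of edges incident to $v$, a loop being counted twice. $\Gamma$ is $\mathbb Z^d$-periodic if: (1) every bounded domain in $\mathbb R^d$ contains finitely many vertices; (2) all degrees are finite; (3) there is a basis $a_1,\ldots,a_d$ of $\mathbb R^d$ with $\Gamma+a_s=\Gamma$ for $s=1,\ldots,d$. Coordinates in $\mathbb R^d$ are taken with respect to a fixed origin and the basis $a_1,\ldots,a_d$, so that $\Gamma+m=\Gamma$ for all $m\in\mathbb Z^d$; two vertices or edges are $\mathbb Z^d$-equivalent if one is the translate of the other by some $m\in\mathbb Z^d$. The fundamental graph is the finite graph $\Gamma_F=(V_F,\mathcal E_F)=\Gamma/\mathbb Z^d$; its vertex set is identified with $V_F=[0,1)^d\cap V=\{v_1,\ldots,v_\nu\}$, $\nu=\#V_F<\infty$. To each unoriented edge correspond two oriented edges $(u,v)$ and $(v,u)$; $\mathcal A_F$ is the set of oriented edges of $\Gamma_F$. Each $v\in V$ is written uniquely as $v=[v]+\tilde v$ with $[v]\in\mathbb Z^d$, $\tilde v\in V_F$. For an oriented edge $\mathbf e=(u,v)$ of $\Gamma$ its index is $\tau(\mathbf e)=[v]-[u]\in\mathbb Z^d$; it is invariant under $\mathbb Z^d$-translations and therefore defines an index for each oriented edge of $\Gamma_F$. **Schrödinger operator.** The normalized Laplacian on $\ell^2(V)$ is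 $$(\Delta f)(v)=-\frac1{\sqrt{\varkappa_v}}\sum_{(v,u)_e\in\mathcal E}\frac1{\sqrt{\varkappa_u}}f(u),\qquad v\in V,$$ where the sum is over edges incident to $v$ (with multiplicity) and loops are counted twice. $H=\Delta+Q$, where $(Qf)(v)=Q(v)f(v)$ and $Q:V\to\mathbb R$ satisfies $Q(v+a_s)=Q(v)$ for all $v\in V$, $s=1,\ldots,d$. **Bands.** Let $\mathbb T^d=\mathbb R^d/(2\pi\mathbb Z)^d$. $H$ is unitarily equivalent to the direct integral $\frac1{(2\pi)^d}\int^\oplus_{\mathbb T^d}H(\vartheta)\,d\vartheta$ with $\nu\times\nu$ Floquet matrices $H(\vartheta)=\Delta(\vartheta)+\mathrm{diag}(Q(v_1),\ldots,Q(v_\nu))$, where $$\Delta_{jk}(\vartheta)=-\frac1{\sqrt{\varkappa_{v_j}\varkappa_{v_k}}}\sum_{\mathbf e=(v_j,v_k)\in\mathcal A_F}e^{i\langle\tau(\mathbf e),\vartheta\rangle}$$ (equal to $0$ if there is no such edge). Let $\lambda_1(\vartheta)\le\ldots\le\lambda_\nu(\vartheta)$ be the eigenvalues of $H(\vartheta)$ counted with multiplicity. The bands of $H$ are $\sigma_n(H)=\lambda_n(\mathbb T^d)=[\lambda_n^-,\lambda_n^+]$, $n=1,\ldots,\nu$ (possibly degenerate to points). **Fundamental domain.** A subgraph $\Gamma_1=(V_1,\mathcal E_1)$ of $\Gamma$ is a fundamental domain if: (1) it is a finite connected graph with $V_1\supset V_F$; (2) it contains no two distinct $\mathbb Z^d$-equivalent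 edges; (3) $\bigcup_{m\in\mathbb Z^d}(\Gamma_1+m)=\Gamma$. Let $\varkappa_v^1$ be the degree of $v\in V_1$ in $\Gamma_1$. The set of inner vertices is $V_o=\{v\in V_1:\varkappa_v=\varkappa_v^1\}$ and the boundary is $\partial V_1=V_1\setminus V_o$. One has $V_o\subset V_F$, so $0\le\nu_o\le\nu\le\nu_1$. **Neumann and Dirichlet operators on $\Gamma_1$.** The Neumann operator $H_1$ on $\ell^2(V_1)$ is the Schrödinger operator on the finite graph $\Gamma_1$: $(H_1f)(v)=-\frac1{\sqrt{\varkappa_v^1}}\sum_{(v,u)_e\in\mathcal E_1}\frac1{\sqrt{\varkappa_u^1}}f(u)+Q(v)f(v)$, $v\in V_1$ (loops counted twice). The self-adjoint Dirichlet operator $H_o$ is given by $H_of=H_1f$ for $f$ with $f|_{\partial V_1}=0$, and is identified with the operator on $\ell^2(V_o)$ whose matrix is the submatrix of $H_1$ with rows and columns indexed by $V_o$; thus $H_o$ has $\nu_o$ eigenvalues. *)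

(* Defs.v *)
From HB Require Import structures.
From mathcomp Require Import all_boot all_order all_algebra.
From mathcomp Require Import finmap complex.
From mathcomp Require Import all_classical all_reals all_analysis.

Set Implicit Arguments.
Unset Strict Implicit.
Unset Printing Implicit Defensive.

Import Order.TTheory GRing.Theory Num.Theory.
Import numFieldNormedType.Exports.

Local Open Scope classical_set_scope.
Local Open Scope ring_scope.

(* A graph in R^d, possibly with loops and multiple edges: vertices are points
   of R^d, edges form an abstract type with an endpoint map (only incidence
   matters, so the arcs realizing the edges are not recorded).  The order of
   the two endpoints is a reference orientation without meaning of its own;
   both orientations of each edge are considered below (oedge).
   The rows of [basis] are a_1, ..., a_d; coordinates are taken with respect to
   [origin] and these vectors.  Since distinct edges may share their endpoints,
   the translation of edges by m in Z^d is part of the data.  A translation by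
   m <> 0 fixes no unordered pair of points, so the reference orientation can
   always be chosen translation-invariant, which is_periodic demands. *)
Record graph (R : realType) (d : nat) := Graph {
  edge : choiceType;
  vertex : set 'rV[R]_d;
  ends : edge -> 'rV[R]_d * 'rV[R]_d;
  origin : 'rV[R]_d;
  basis : 'M[R]_d;
  etrans : 'rV[int]_d -> edge -> edge
}.

Section PeriodicGraphs.
Variables (R : realType) (d : nat) (G : graph R d).

Local Notation point := 'rV[R]_d.
Local Notation Zd := 'rV[int]_d.
Local Notation C := R[i].

Definition coord (x : point) : point := (x - origin G) *m invmx (basis G).

Definition lattice_vec (m : Zd) : point := map_mx intr m *m basis G.

Definition vtrans (m : Zd) (x : point) : point := x + lattice_vec m.

(* x = frac x + [x], where [x] = cell x is in Z^d and frac x has coordinates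
   in [0, 1). *)
Definition cell (x : point) : Zd := map_mx Num.floor (coord x).

Definition frac (x : point) : point := x - lattice_vec (cell x).

Definition oedge : Type := (edge G * bool)%type.

Definition src (a : oedge) : point :=
  if a.2 then (ends a.1).1 else (ends a.1).2.

Definition tgt (a : oedge) : point :=
  if a.2 then (ends a.1).2 else (ends a.1).1.

Definition otrans (m : Zd) (a : oedge) : oedge := (etrans m a.1, a.2).

(* The oriented edges starting at v and carried by the edges in S.  A loop at v
   contributes two of them, so counting or summing over this set counts loops
   twice. *)
Definition out (S : set (edge G)) (v : point) : set (edge G * bool) :=
  [set a | S a.1 /\ src a = v].

Definition deg (S : set (edge G)) (v : point) : nat := #|` fset_set (out S v)|.

Fixpoint walk (S : set (edge G)) (u : point) (p : seq oedge) (v : point) :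
    Prop :=
  if p is a :: p' then [/\ S a.1, src a = u & walk S (tgt a) p' v] else u = v.

Definition is_subgraph (W : set point) (S : set (edge G)) : Prop :=
  W `<=` vertex G /\
  (forall e, S e -> W (ends e).1 /\ W (ends e).2).

Definition graph_connected (W : set point) (S : set (edge G)) : Prop :=
  forall u v, W u -> W v -> exists p, walk S u p v.

Definition is_periodic : Prop :=
  [/\ is_subgraph (vertex G) setT,
      infinite_set (vertex G) /\ graph_connected (vertex G) setT,
      forall B : set point, bounded_set B -> finite_set (vertex G `&` B),
      forall v, vertex G v -> finite_set (out setT v)
    & [/\ basis G \in unitmx,
      forall m v, vertex G v -> vertex G (vtrans m v),
      forall e : edge G, etrans 0 e = e,
      forall (m m' : Zd) (e : edge G), etrans (m + m') e = etrans m (etrans m' e)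
    & forall m (e : edge G),
        ends (etrans m e) = (vtrans m (ends e).1, vtrans m (ends e).2)]].

Definition is_periodic_potential (Q : point -> R) : Prop :=
  forall v, vertex G v -> forall s : 'I_d, Q (v + row s (basis G)) = Q v.

Definition VF : set point :=
  [set v | vertex G v /\ forall s, 0 <= coord v 0 s < 1].

(* The quotient graph: an oriented edge of Gamma / Z^d is an orbit of oriented
   edges of Gamma. *)
Definition orbit_of (a : oedge) : set oedge := [set otrans m a | m in setT].

Definition AF (u w : point) : set (set oedge) :=
  [set O | exists a, [/\ O = orbit_of a, frac (src a) = u & frac (tgt a) = w]].

Definition edge_index (a : oedge) : Zd := cell (tgt a) - cell (src a).

(* On a periodic graph, edge_index is constant on each orbit. *)
Definition orbit_index (O : set oedge) : Zd := xget 0 [set edge_index a | a in O].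

Definition cis (t : R) : C := (cos t +i* sin t)%C.

Definition dotZ (m : Zd) (theta : point) : R :=
  \sum_(s < d) (m 0 s)%:~R * theta 0 s.

(* nth_pt A i is the i-th point of the finite set A in a fixed enumeration; the
   eigenvalues below do not depend on the enumeration. *)
Definition size_of (A : set point) : nat := #|` fset_set A|.

Definition nth_pt (A : set point) (i : 'I_(size_of A)) : point :=
  nth 0 (fset_set A) i.

Definition floquet (Q : point -> R) (theta : point) : 'M[C]_(size_of VF) :=
  \matrix_(j, k)
    (- ((Num.sqrt ((deg setT (nth_pt j))%:R * (deg setT (nth_pt k))%:R))^-1)%:C%C
       * (\sum_(O \in AF (nth_pt j) (nth_pt k))
            cis (dotZ (orbit_index O) theta))
     + if j == k then (Q (nth_pt j))%:C%C else 0).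

(* The Schroedinger operator on the subgraph of G with edge set S, degrees being
   taken in the subgraph; S = setT gives the operator H on Gamma itself. *)
Definition schroedinger (S : set (edge G)) (Q : point -> R) (f : point -> C)
    (v : point) : C :=
  - ((Num.sqrt ((deg S v)%:R : R))^-1)%:C%C
    * (\sum_(a \in out S v)
         ((Num.sqrt ((deg S (tgt a))%:R : R))^-1)%:C%C * f (tgt a))
  + (Q v)%:C%C * f v.

(* The matrix of the compression of T to the functions supported on A, in the
   basis of indicators of the points of A. *)
Definition compression (T : (point -> C) -> point -> C) (A : set point) :
    'M[C]_(size_of A) :=
  \matrix_(i, j) T (fun x => (x == nth_pt j)%:R) (nth_pt i).

Definition is_fundamental_domain (V1 : set point) (E1 : set (edge G)) : Prop :=
  [/\ is_subgraph V1 E1,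
      [/\ finite_set V1, finite_set E1, graph_connected V1 E1 & VF `<=` V1],
      forall (e : edge G) (m : Zd), E1 e -> E1 (etrans m e) -> etrans m e = e,
      forall v, vertex G v -> exists m w, V1 w /\ v = vtrans m w
    & forall e : edge G, exists (m : Zd) (e' : edge G), E1 e' /\ e = etrans m e'].

Definition inner (V1 : set point) (E1 : set (edge G)) : set point :=
  [set v | V1 v /\ deg setT v = deg E1 v].

Definition neumann (V1 : set point) (E1 : set (edge G)) (Q : point -> R) :=
  compression (schroedinger E1 Q) V1.

Definition dirichlet (V1 : set point) (E1 : set (edge G)) (Q : point -> R) :=
  compression (schroedinger E1 Q) (inner V1 E1).

End PeriodicGraphs.

(* The roots of the characteristic polynomial with multiplicity, in
   nondecreasing order.  It is only used for Hermitian matrices, whose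
   eigenvalues are real, so that complex.Re loses nothing. *)
Definition eigenvalues (R : realType) (n : nat) (A : 'M[R[i]]_n) : seq R :=
  sort <=%O [seq complex.Re z | z <- sval (closed_field_poly_normal (char_poly A))].

(* s_n with indices starting from 1. *)
Definition nth1 (R : realType) (s : seq R) (n : nat) : R := nth 0 s n.-1.

Definition eig (R : realType) (k : nat) (A : 'M[R[i]]_k) (n : nat) : R :=
  nth1 (eigenvalues A) n.

(* A function on the torus is a 2pi-periodic function on R^d, with the same
   image. *)
Definition band (R : realType) (d : nat) (G : graph R d) (Q : 'rV[R]_d -> R)
    (n : nat) : set R :=
  [set eig (floquet G Q theta) n | theta in setT].

Definition sorted_values (R : realType) (d : nat) (Q : 'rV[R]_d -> R)
    (A : set 'rV[R]_d) : seq R :=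
  sort <=%O [seq Q v | v <- fset_set A].

Definition intervalJ (R : realType) (d : nat) (G : graph R d)
    (V1 : set 'rV[R]_d) (E1 : set (edge G)) (Q : 'rV[R]_d -> R) (n : nat) :
    set R :=
  let nuo := size_of (inner V1 E1) in
  let lam1 := eig (neumann V1 E1 Q) in
  let lamo := eig (dirichlet V1 E1 Q) in
  let q := nth1 (sorted_values Q (VF G)) in
  if (n <= nuo)%N then `[lam1 n, lamo n]%classic else `[lam1 n, q n + 1]%classic.

Definition intervalK (R : realType) (d : nat) (G : graph R d)
    (V1 : set 'rV[R]_d) (E1 : set (edge G)) (Q : 'rV[R]_d -> R) (n : nat) :
    set R :=
  let nu := size_of (VF G) in
  let nu1 := size_of V1 in
  let nuo := size_of (inner V1 E1) in
  let lam1 := eig (neumann V1 E1 Q) in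
  let lamo := eig (dirichlet V1 E1 Q) in
  let q := nth1 (sorted_values Q (VF G)) in
  if (n <= nu - nuo)%N then `[q n - 1, lam1 (n + nu1 - nu)%N]%classic
  else `[lamo (n + nuo - nu)%N, lam1 (n + nu1 - nu)%N]%classic.

(* Main.v *)
(* Extend f on V_F quasi-periodically with quasi-momentum theta and rescale the
   value at v in V_1 by the square root of deg_1 v / deg v.  Since E_1 meets
   every orbit of edges exactly once, the degrees in Gamma_1 of the translates
   of u in V_1 add up to the degree of u in Gamma, so this is an isometry
   P^* : l^2(V_F) -> l^2(V_1), and H(theta) = P H_1 P^*.  The orbit of an inner
   vertex meets V_1 only once, so H_o is a principal submatrix of H(theta).
   Cauchy interlacing for the compressions H_1 -> H(theta) -> H_o gives the
   bounds by the lambda^1 and the lambda^o; the bounds q_n - 1 and q_n + 1 hold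
   because -1 <= Delta(theta) <= 1, that is, because Delta(theta) = - S T^* with
   isometries S^*, T^* such that S T^* = T S^*. *)

Require Import Defs.
From HB Require Import structures.
From mathcomp Require Import all_boot all_order all_algebra.
From mathcomp Require Import finmap complex.
From mathcomp Require Import all_classical all_reals all_analysis.
From mathcomp Require Import zify.

Set Implicit Arguments.
Unset Strict Implicit.
Unset Printing Implicit Defensive.

Import Order.TTheory GRing.Theory Num.Theory.
Import numFieldNormedType.Exports.

Local Open Scope classical_set_scope.
Local Open Scope ring_scope.
Local Open Scope sesquilinear_scope.

(** * Eigenvalues of Hermitian matrices *)

Section HermitianEigenvalues.
Variable R : realType.
Local Notation C := R[i].

(** Vectors are rows. A rectangular P in [unitarymx] satisfies P P^* = 1, so x -> x P is an
    isometric embedding and P stands for the span of its rows. *)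
Definition qform n (A : 'M[C]_n) (x : 'rV[C]_n) : C := (x *m A *m x^t*) 0 0.

Lemma qformD n (A B : 'M[C]_n) x : qform (A + B) x = qform A x + qform B x.
Proof. by rewrite /qform mulmxDr mulmxDl mxE. Qed.

Lemma qformZ n a (A : 'M[C]_n) x : qform (a *: A) x = a * qform A x.
Proof. by rewrite /qform -scalemxAr -scalemxAl mxE. Qed.

Lemma qform_mul m n (A : 'M[C]_n) (P : 'M[C]_(m, n)) x :
  qform A (x *m P) = qform (P *m A *m P^t*) x.
Proof. by rewrite /qform trmx_mul map_mxM !mulmxA. Qed.

Lemma qform_diag n (d x : 'rV[C]_n) :
  qform (diag_mx d) x = \sum_i d 0 i * `|x 0 i| ^+ 2.
Proof.
rewrite /qform mxE; apply: eq_bigr => i _.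
by rewrite mul_mx_diag !mxE normCK mulrA (mulrC (d _ _)).
Qed.

Lemma qform1 n (x : 'rV[C]_n) : qform 1%:M x = \sum_i `|x 0 i| ^+ 2.
Proof.
rewrite -diag_const_mx qform_diag; apply: eq_bigr => i _.
by rewrite mxE mul1r.
Qed.

Lemma qform1_unitary m n (P : 'M[C]_(m, n)) x :
  P \is unitarymx -> qform 1%:M (x *m P) = qform 1%:M x.
Proof. by move=> /unitarymxP PP; rewrite qform_mul mulmx1 PP. Qed.

Lemma qform1_gt0 n (x : 'rV[C]_n) : x != 0 -> 0 < qform 1%:M x.
Proof.
move=> x0; rewrite qform1 lt_def sumr_ge0 ?andbT => [|i _]; last first.
  by rewrite exprn_ge0.
apply: contra x0 => /eqP/psumr_eq0P/= x0; apply/eqP/rowP => i.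
have /eqP := x0 (fun i _ => exprn_ge0 2 (normr_ge0 _)) i isT.
by rewrite expf_eq0/= normr_eq0 mxE => /eqP.
Qed.

(** Unique factorization fixes the multiset of roots; sorting removes the arbitrary order given by
    [closed_field_poly_normal]. *)
Lemma eigenvalues_char_poly n (A : 'M[C]_n) (d : 'I_n -> R) :
  char_poly A = \prod_(i < n) ('X - (d i)%:C%C%:P) ->
  eigenvalues A = sort <=%O [seq d i | i <- enum 'I_n].
Proof.
move=> Ad; rewrite /eigenvalues; case: closed_field_poly_normal => s /= As.
apply/perm_sort_leP.
have: perm_eq s [seq (d i)%:C%C | i <- enum 'I_n].
  apply: prod_XsubC_eq; rewrite big_map big_enum -Ad As.
  by rewrite (monicP (char_poly_monic A)) scale1r.
move=> /(perm_map (@complex.Re R)) /perm_trans; apply.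
by rewrite -map_comp (eq_map (g := d)).
Qed.

Lemma eigenvalues_diag n (d : 'I_n -> R) :
  eigenvalues (diag_mx (\row_i (d i)%:C%C)) =
  sort <=%O [seq d i | i <- enum 'I_n].
Proof.
apply: eigenvalues_char_poly; rewrite char_poly_trig ?diag_mx_is_trig//.
by apply: eq_bigr => i _; rewrite !mxE eqxx mulr1n.
Qed.

Lemma hermitian_diagonalization n (A : 'M[C]_n) : A \is hermsymmx ->
  exists (U : 'M[C]_n) (d : 'I_n -> R),
    [/\ U \is unitarymx, A = U^t* *m diag_mx (\row_i (d i)%:C%C) *m U
      & eigenvalues A = sort <=%O [seq d i | i <- enum 'I_n]].
Proof.
move=> Aherm; have /orthomx_spectralP Adiag := hermitian_normalmx Aherm.
have Uu := spectral_unitarymx A.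
have dR := hermitian_spectral_diag_real Aherm.
pose d i : R := complex.Re (spectral_diag A 0 i).
have dE : spectral_diag A = \row_i (d i)%:C%C.
  by apply/rowP => i; rewrite !mxE RRe_real//; exact: (mxOverP dR).
exists (spectralmx A), d; split=> //.
  by rewrite -invmx_unitary// -dE.
(* [eigenvalues] depends only on the characteristic polynomial, which is invariant under
   conjugation. *)
rewrite -eigenvalues_diag -dE /eigenvalues; congr (sort _ (map _ _)).
congr (sval (closed_field_poly_normal _)).
rewrite {1}Adiag /char_poly /char_poly_mx.
set U := spectralmx A; set D := diag_mx _.
have UV : map_mx polyC (invmx U) *m map_mx polyC U = 1%:M.
  by rewrite -map_mxM mulVmx ?map_mx1// unitarymx_unit.
have -> : 'X%:M - map_mx polyC (invmx U *m D *m U) =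
    map_mx polyC (invmx U) *m ('X%:M - map_mx polyC D) *m map_mx polyC U.
  rewrite mulmxBr mulmxBl !map_mxM; congr (_ - _).
  by rewrite -scalemx1 -scalemxAr mulmx1 -scalemxAl UV.
by rewrite !det_mulmx mulrAC -det_mulmx UV det1 mul1r.
Qed.

Lemma size_eigenvalues n (A : 'M[C]_n) : A \is hermsymmx ->
  size (eigenvalues A) = n.
Proof.
move=> /hermitian_diagonalization[_ [d [_ _ ->]]].
by rewrite size_sort size_map size_enum_ord.
Qed.

(** * Spectral subspaces and comparison of eigenvalues *)

Lemma count_le_nth (s : seq R) k : sorted <=%O s -> (k < size s)%N ->
  (k < count (<= nth 0%R s k)%O s)%N.
Proof.
move=> ss ks; rewrite -{2}(cat_take_drop k.+1 s) count_cat.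
apply: leq_trans (leq_addr _ _).
suff /[!all_count]/eqP-> : all (<= nth 0 s k)%O (take k.+1 s).
  by rewrite size_take_min leq_min leqnn ks.
apply/(all_nthP 0) => i; rewrite size_take_min leq_min => /andP[ik is_].
rewrite nth_take//=; exact: (sorted_leq_nth le_trans le_refl 0 ss).
Qed.

Lemma count_ge_nth (s : seq R) k : sorted <=%O s -> (k < size s)%N ->
  (size s - k <= count (>= nth 0%R s k)%O s)%N.
Proof.
move=> ss ks; rewrite -{3}(cat_take_drop k s) count_cat.
apply: leq_trans (leq_addl _ _).
suff /[!all_count]/eqP-> : all (>= nth 0 s k)%O (drop k s).
  by rewrite size_drop.
apply/(all_nthP 0) => i; rewrite size_drop => ik.
rewrite nth_drop/=; apply: (sorted_leq_nth le_trans le_refl 0 ss) => //.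
  by rewrite inE -ltn_subRL.
exact: leq_addr.
Qed.

(** The rows of [L] are the eigenvectors whose eigenvalue satisfies [p], and [z] holds coordinates
    in the full eigenbasis. Leaving [p] free serves both half-lines below. *)
Lemma spectral_subspace n (A : 'M[C]_n) (p : pred R) : A \is hermsymmx ->
  exists m (L : 'M[C]_(m, n)),
    [/\ m = count p (eigenvalues A), L \is unitarymx &
      forall x, exists (d : 'I_n -> R) (z : 'rV[C]_n),
        [/\ qform A (x *m L) = \sum_i (d i)%:C%C * `|z 0 i| ^+ 2,
            qform 1%:M (x *m L) = \sum_i `|z 0 i| ^+ 2
          & forall i, z 0 i != 0 -> p (d i)]].
Proof.
move=> /hermitian_diagonalization[U [d [Uu AE ->]]].
pose I := finset (fun i => p (d i)).
pose S : 'M[C]_(#|I|, n) := \matrix_(k, i) (enum_val k == i)%:R.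
have Su : S \is unitarymx.
  apply/unitarymxP/matrixP => k l.
  rewrite !mxE (bigD1 (enum_val k))//= !mxE eqxx mul1r big1 ?addr0.
    by rewrite conjC_nat (inj_eq enum_val_inj) eq_sym.
  by move=> i ik; rewrite !mxE eq_sym (negPf ik) mul0r.
exists #|I|, (S *m U); split=> [||x]; last exists d, (x *m S).
- rewrite (permP (permEl (perm_sort _ _))) count_map enumT.
  by rewrite cardsE cardE /enum_mem size_filter.
- exact: mul_unitarymx.
have Pd i : (x *m S) 0 i != 0 -> p (d i).
  apply: contraNT => pdi; apply/eqP; rewrite mxE big1// => k _; rewrite mxE.
  case: eqP => [ki|]; last by rewrite mulr0.
  by have := enum_valP k; rewrite ki inE (negPf pdi).
split=> //; last by rewrite mulmxA qform1_unitary// qform1.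
rewrite mulmxA qform_mul AE !mulmxA (unitarymxP Uu) mul1mx mulmxtVK//.
rewrite qform_diag.
by apply: eq_bigr => i _; rewrite mxE.
Qed.

(** One half of the min-max principle: at least k eigenvalues, with multiplicity, are at most the
    k-th. *)
Lemma eig_low_subspace n (A : 'M[C]_n) k : A \is hermsymmx -> (0 < k <= n)%N ->
  exists m (L : 'M[C]_(m, n)), [/\ (k <= m)%N, L \is unitarymx &
    forall x, qform A (x *m L) <= (eig A k)%:C%C * qform 1%:M (x *m L)].
Proof.
move=> Ah /andP[k0 kn].
have [m [L [mE Lu Lx]]] := spectral_subspace (fun r => r <= eig A k) Ah.
exists m, L; split=> // [|x].
  (* [eig] counts from 1 and [nth] from 0, so the position is [k.-1]. *)
  rewrite mE -{1}(prednK k0); apply: count_le_nth; first exact: sort_le_sorted.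
  by rewrite size_eigenvalues// prednK.
have [d [z [-> -> dz]]] := Lx x; rewrite mulr_sumr; apply: ler_sum => i _.
have [->|/dz di] := eqVneq (z 0 i) 0; first by rewrite normr0 expr0n !mulr0.
by rewrite ler_wpM2r ?exprn_ge0// lecR.
Qed.

(** The other half: at least n - k + 1 eigenvalues are no smaller than the k-th. *)
Lemma eig_high_subspace n (A : 'M[C]_n) k : A \is hermsymmx -> (0 < k <= n)%N ->
  exists m (L : 'M[C]_(m, n)), [/\ (n < k + m)%N, L \is unitarymx &
    forall x, (eig A k)%:C%C * qform 1%:M (x *m L) <= qform A (x *m L)].
Proof.
move=> Ah /andP[k0 kn].
have [m [L [mE Lu Lx]]] := spectral_subspace (fun r => eig A k <= r) Ah.
exists m, L; split=> // [|x].
  rewrite -(prednK k0) addSn ltnS -leq_subLR mE -{1}(size_eigenvalues Ah).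
  apply: count_ge_nth; first exact: sort_le_sorted.
  by rewrite size_eigenvalues// prednK.
have [d [z [-> -> dz]]] := Lx x; rewrite mulr_sumr; apply: ler_sum => i _.
have [->|/dz di] := eqVneq (z 0 i) 0; first by rewrite normr0 expr0n !mulr0.
by rewrite ler_wpM2r ?exprn_ge0// lecR.
Qed.

(* Two subspaces of C^N whose dimensions add up to more than N intersect. *)
Lemma eig_compare m n N (B : 'M[C]_m) (A : 'M[C]_n)
    (S : 'M[C]_(m, N)) (P : 'M[C]_(n, N)) (c : R) i j :
  B \is hermsymmx -> A \is hermsymmx ->
  S \is unitarymx -> P \is unitarymx ->
  (forall y x, y *m S = x *m P ->
     qform B y <= qform A x + c%:C%C * qform 1%:M x) ->
  (0 < i <= m)%N -> (0 < j <= n)%N -> (N + i <= m + j)%N ->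
  eig B i <= eig A j + c.
Proof.
move=> Bh Ah Su Pu le_form im jn Nij.
have [p [L [kp Lu Lx]]] := eig_low_subspace Ah jn.
have [q [M [kq Mu My]]] := eig_high_subspace Bh im.
pose V := M *m S; pose W := L *m P.
have Vu : V \is unitarymx by exact: mul_unitarymx.
have Wu : W \is unitarymx by exact: mul_unitarymx.
have cap0 : (V :&: W)%MS != 0.
  rewrite -mxrank_eq0 -lt0n -(ltn_add2l (\rank (V + W)%MS)) addn0.
  rewrite mxrank_sum_cap (mxrank_unitary Vu) (mxrank_unitary Wu).
  (* Since q > m - i and p >= j, the assumption N + i <= m + j gives p + q > N. *)
  by apply: leq_ltn_trans (rank_leq_col _) _; lia.
set v := nz_row (V :&: W)%MS.
have v0 : v != 0 by rewrite nz_row_eq0.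
have /andP[/submxP[y vy] /submxP[x vx]] : (v <= V)%MS && (v <= W)%MS.
  by rewrite -sub_capmx nz_row_sub.
rewrite mulmxA in vy; rewrite mulmxA in vx.
have yx : y *m M *m S = x *m L *m P by rewrite -vy.
(* The lower bound for B, the comparison of forms and the upper bound for A are chained; all norms
   equal that of [v], which is then divided out. *)
have := le_trans (My y) (le_trans (le_form _ _ yx) (lerD (Lx x) (lexx _))).
rewrite -(qform1_unitary (y *m M) Su) yx -vx.
rewrite (_ : qform _ (x *m L) = qform 1%:M v).
  rewrite -mulrDl ler_pM2r ?qform1_gt0// -rmorphD/=.
  by rewrite lecR.
by rewrite vx (qform1_unitary _ Pu).
Qed.

Lemma hermsymmxP n (A : 'M[C]_n) : A^t* = A -> A \is hermsymmx.
Proof. by move=> AA; apply/is_hermitianmxP; rewrite expr0 scale1r AA. Qed.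

Lemma hermitian_diag n (d : 'I_n -> R) :
  (diag_mx (\row_i (d i)%:C%C))^t* = diag_mx (\row_i (d i)%:C%C) :> 'M[C]_n.
Proof.
rewrite tr_diag_mx map_diag_mx; congr diag_mx; apply/rowP => i; rewrite !mxE.
by apply/eqP; rewrite eq_complex/= oppr0 !eqxx.
Qed.

Lemma herm_compression m n (A : 'M[C]_n) (P : 'M[C]_(m, n)) :
  A \is hermsymmx -> P *m A *m P^t* \is hermsymmx.
Proof.
move=> /is_hermitianmxP; rewrite expr0 scale1r => AE; apply: hermsymmxP.
by rewrite !trmx_mul !map_mxM trmxCK -AE mulmxA.
Qed.

Lemma unitarymx1 n : 1%:M \is @unitarymx C n n.
Proof. by apply/unitarymxP; rewrite trmx1 map_mx1 mulmx1. Qed.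

Lemma eig_le_qform n (A B : 'M[C]_n) (c : R) k :
  B \is hermsymmx -> A \is hermsymmx ->
  (forall x, qform B x <= qform A x + c%:C%C * qform 1%:M x) ->
  (0 < k <= n)%N -> eig B k <= eig A k + c.
Proof.
move=> Bh Ah BA kn.
have u1 := unitarymx1 n.
by apply: (eig_compare Bh Ah u1 u1) => // y x; rewrite !mulmx1 => ->.
Qed.

(** The form of P A P^* at x is that of A at x P, so [eig_compare] applies with c = 0 in both
    directions; the shift n - m is the codimension of the row space of P. *)
Lemma cauchy_interlacing m n (A : 'M[C]_n) (P : 'M[C]_(m, n)) k :
  A \is hermsymmx -> P \is unitarymx -> (0 < k <= m)%N ->
  eig A k <= eig (P *m A *m P^t*) k <= eig A (k + n - m).
Proof.
move=> Ah Pu /andP[k0 km]; have Bh := herm_compression P Ah.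
have u1 := unitarymx1 n.
have mn : (m <= n)%N by rewrite -(mxrank_unitary Pu) rank_leq_col.
apply/andP; split.
- rewrite -[X in _ <= X]addr0.
  apply: (eig_compare Ah Bh u1 Pu) => [y x|||]; [|lia..].
  by rewrite mulmx1 => ->; rewrite qform_mul mul0r addr0.
- rewrite -[X in _ <= X]addr0.
  apply: (eig_compare Bh Ah Pu u1) => [y x|||]; [|lia..].
  by rewrite mulmx1 => <-; rewrite qform_mul mul0r addr0.
Qed.

Lemma qform_sqr_ge0 m n (M : 'M[C]_(m, n)) x : 0 <= qform (M *m M^t*) x.
Proof.
rewrite -[M in M *m _]mulmx1 -qform_mul qform1.
by apply: sumr_ge0 => i _; rewrite exprn_ge0.
Qed.

(* (S - T) (S - T)^* = 2 (1 - S T^* ) and (S + T) (S + T)^* = 2 (1 + S T^* ). *)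
Lemma qform_unitary_mul m n (S T : 'M[C]_(m, n)) x :
  S \is unitarymx -> T \is unitarymx -> T *m S^t* = S *m T^t* ->
  - qform 1%:M x <= qform (S *m T^t*) x <= qform 1%:M x.
Proof.
move=> /unitarymxP SS /unitarymxP TT TS.
(* Both signs e = 1 and e = -1 at once; the two cross terms coincide by [TS]. *)
have sqr (e : C) : e^* = e -> e * e = 1 ->
    0 <= qform 1%:M x + e * qform (S *m T^t*) x.
  move=> eJ ee; have := qform_sqr_ge0 (S + e *: T) x.
  have -> : (S + e *: T)^t* = S^t* + e *: T^t*.
    apply/matrixP => i j; rewrite !mxE rmorphD rmorphM; congr (_ + _ * _).
    exact: eJ.
  rewrite mulmxDl !mulmxDr.
  rewrite -!scalemxAl -!scalemxAr SS TT TS scalerA ee scale1r.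
  rewrite [e *: _ + 1%:M]addrC qformD -mulr2n pmulrn_lge0//.
  by rewrite qformD qformZ.
apply/andP; split.
- have := sqr 1; rewrite conjC1 !mul1r.
  by rewrite -[_ <= qform (S *m _) _]subr_ge0 opprK addrC; apply.
- have := sqr (-1); rewrite mulN1r opprK mulN1r subr_ge0; apply=> //.
  by rewrite rmorphN; congr (- _); exact: conjC1.
Qed.

End HermitianEigenvalues.

(** * Periodic graphs and fundamental domains *)

Section Combinatorics.
Variables (R : realType) (d : nat) (G : graph R d).
Hypothesis hG : is_periodic G.
Local Notation point := 'rV[R]_d.
Local Notation Zd := 'rV[int]_d.
Local Notation basis := Defs.basis.
Local Notation frac := Defs.frac.
Local Notation coord := Defs.coord.
Local Notation arc := (edge G * bool)%type.

(** * Lattice translations, cells and orbits *)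

Lemma lattice_vecD m m' :
  lattice_vec G (m + m') = lattice_vec G m + lattice_vec G m'.
Proof. by rewrite /lattice_vec map_mxD mulmxDl. Qed.

Lemma lattice_vecN m : lattice_vec G (- m) = - lattice_vec G m.
Proof. by rewrite /lattice_vec map_mxN mulNmx. Qed.

Lemma lattice_vec0 : lattice_vec G 0 = 0.
Proof. by rewrite /lattice_vec map_mx0 mul0mx. Qed.

Lemma vtransD m m' (x : point) :
  vtrans G (m + m') x = vtrans G m (vtrans G m' x).
Proof. by rewrite /vtrans lattice_vecD [lattice_vec _ m + _]addrC addrA. Qed.

Lemma vtrans0 (x : point) : vtrans G 0 x = x.
Proof. by rewrite /vtrans lattice_vec0 addr0. Qed.

Lemma vtransK m : cancel (vtrans G m) (vtrans G (- m)).
Proof. by move=> x; rewrite -vtransD addNr vtrans0. Qed.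

Lemma basis_unit : basis G \in unitmx.
Proof. by case: hG => _ _ _ _ []. Qed.

Lemma cell_vtrans m (x : point) : cell G (vtrans G m x) = cell G x + m.
Proof.
apply/rowP => s; rewrite /cell /coord /vtrans addrAC mulmxDl.
rewrite /lattice_vec mulmxK ?basis_unit// !mxE.
by rewrite floorDrz ?intr_int// intrKfloor.
Qed.

Lemma frac_vtrans m (x : point) : frac G (vtrans G m x) = frac G x.
Proof.
rewrite /frac cell_vtrans lattice_vecD /vtrans opprD addrACA.
by rewrite subrr addr0.
Qed.

Lemma vtrans_frac (x : point) : vtrans G (cell G x) (frac G x) = x.
Proof. by rewrite /vtrans /frac subrK. Qed.

Lemma fracE (x : point) : frac G x = vtrans G (- cell G x) x.
Proof. by rewrite /frac /vtrans lattice_vecN. Qed.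

Lemma cell_frac (x : point) : cell G (frac G x) = 0.
Proof. by rewrite fracE cell_vtrans subrr. Qed.

Lemma vertex_vtrans m (v : point) : vertex G v -> vertex G (vtrans G m v).
Proof. by case: hG => _ _ _ _ [_ + _ _ _]; apply. Qed.

(** A coordinate is in [0, 1) exactly when its floor is 0. This trades inequalities for an equation
    on [cell], whose behaviour under translations is known. *)
Lemma VFP (v : point) : VF G v <-> vertex G v /\ cell G v = 0.
Proof.
split=> -[vv v0]; split=> //.
  apply/rowP => s; rewrite [LHS]mxE [RHS]mxE; apply/eqP.
  by rewrite floor_eq add0r; exact: v0.
move=> s; have /eqP : cell G v 0 s = 0 by rewrite v0 mxE.
by rewrite [X in X == _]mxE floor_eq add0r.
Qed.

Lemma VF_frac (v : point) : vertex G v -> VF G (frac G v).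
Proof.
move=> vv; apply/VFP; rewrite cell_frac fracE; split=> //.
exact: vertex_vtrans.
Qed.

Lemma frac_VF (v : point) : VF G v -> frac G v = v.
Proof. by move=> /VFP[_ v0]; rewrite fracE v0 oppr0 vtrans0. Qed.

Lemma otransD m m' (a : arc) : otrans (m + m') a = otrans m (otrans m' a).
Proof. by case: hG => _ _ _ _ [_ _ _ + _] => eD; rewrite /otrans/= eD. Qed.

Lemma otrans0 (a : arc) : otrans 0 a = a.
Proof.
case: a => e b; case: hG => _ _ _ _ [_ _ + _ _] => e0.
by rewrite /otrans/= e0.
Qed.

Lemma src_otrans m (a : arc) : src (otrans m a) = vtrans G m (src a).
Proof. by case: hG => _ _ _ _ [_ _ _ _ eE]; rewrite /src/= eE; case: ifP. Qed.

Lemma tgt_otrans m (a : arc) : tgt (otrans m a) = vtrans G m (tgt a).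
Proof. by case: hG => _ _ _ _ [_ _ _ _ eE]; rewrite /tgt/= eE; case: ifP. Qed.

Lemma edge_index_otrans m (a : arc) : edge_index (otrans m a) = edge_index a.
Proof.
rewrite /edge_index src_otrans tgt_otrans !cell_vtrans opprD addrACA.
by rewrite subrr addr0.
Qed.

Lemma orbit_of_otrans m (a : arc) : orbit_of (otrans m a) = orbit_of a.
Proof.
apply/seteqP; split=> b [m' _ <-]; last first.
  by exists (m' - m) => //; rewrite -otransD subrK.
by exists (m' + m) => //; rewrite otransD.
Qed.

Lemma orbit_index_of (a : arc) : orbit_index (orbit_of a) = edge_index a.
Proof.
rewrite /orbit_index; set X := (X in xget _ X).
have Xa : X (edge_index a) by exists a => //; exists 0 => //; exact: otrans0.
(* The orbit contains [a], so the default value of [xget] is excluded, and any chosen index is that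
   of a translate of [a]. *)
case: xgetP => [_ -> [_ [m _ <-] <-]|/(_ _ Xa)//].
exact: edge_index_otrans.
Qed.

Lemma vertex_src (a : arc) : vertex G (src a).
Proof. by case: hG => -[_ /(_ a.1 I)[]]; rewrite /src; case: ifP. Qed.

(** [fset_set] sends infinite sets to the empty one, so this finiteness makes [deg] a true count. *)
Lemma finite_out S (v : point) : vertex G v -> finite_set (out (G:=G) S v).
Proof.
case: hG => _ _ _ fin _ /fin; apply: sub_finite_set => a [_ av]; exact.
Qed.

Lemma deg_gt0 S (v : point) : vertex G v ->
  (0 < deg S v)%N <-> exists a : arc, S a.1 /\ src a = v.
Proof.
move=> vv; rewrite /deg cardfs_gt0; split=> [/fset0Pn[a]|[a av]].
  rewrite in_fset_set; last exact: finite_out.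
  by rewrite inE => -[]; exists a.
apply/fset0Pn; exists a; rewrite in_fset_set; last exact: finite_out.
by rewrite inE.
Qed.

(** An infinite connected graph has a walk from v to some other vertex, and its first arc leaves
    v. *)
Lemma deg_vertex_gt0 (v : point) : vertex G v -> (0 < deg (G:=G) setT v)%N.
Proof.
move=> vv; apply/deg_gt0 => //; case: hG => _ [Vinf conn] _ _ _.
have [w vw wv] : exists2 w, vertex G w & w <> v.
  apply: contrapT => noW; apply: Vinf; apply: (@sub_finite_set _ _ [set v]).
    by move=> w vw; apply: contrapT => wv; apply: noW; exists w.
  exact: finite_set1.
have [[|a p] /=] := conn v w vv vw; first by move=> /esym.
by case=> _ av _; exists a.
Qed.

(** * Arcs of the fundamental domain as representatives of orbits *)

Variables (V1 : set point) (E1 : set (edge G)).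
Hypothesis hdom : is_fundamental_domain V1 E1.

(** One representative for each orbit of oriented edges: [domain_arcs_cover] gives existence,
    [domain_arcs_otrans] uniqueness. *)
Definition domain_arcs := fset_set [set a : arc | E1 a.1].

Lemma mem_domain_arcs (a : arc) : (a \in domain_arcs) = (a.1 \in E1).
Proof.
rewrite in_fset_set; first by rewrite /in_mem/= /in_set.
case: hdom => _ [_ finE _ _] _ _ _.
rewrite (_ : mkset _ = E1 `*` setT).
  by apply: finite_setX => //; exact: finite_finset.
by apply/seteqP; split=> b //= [].
Qed.

Lemma domain_arcs_otrans m (a : arc) :
  a \in domain_arcs -> otrans m a \in domain_arcs -> otrans m a = a.
Proof.
case: a => e b; rewrite !mem_domain_arcs !inE/= => Ee Eme.
by case: hdom => _ _ /(_ e m Ee Eme) + _ _ => mE; rewrite /otrans/= mE.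
Qed.

Lemma domain_arcs_cover (a : arc) :
  exists m b, b \in domain_arcs /\ a = otrans m b.
Proof.
case: a => e b; case: hdom => _ _ _ _ /(_ e)[m [e' [Ee' ->]]].
by exists m, (e', b); rewrite mem_domain_arcs inE.
Qed.

Lemma V1_src (a : arc) : a \in domain_arcs -> V1 (src a).
Proof.
rewrite mem_domain_arcs inE => Ea; case: hdom => -[_ /(_ _ Ea)[]] + + _ _ _ _.
by rewrite /src; case: ifP.
Qed.

Lemma V1_vertex (v : point) : V1 v -> vertex G v.
Proof. by case: hdom => -[+ _] _ _ _ _; apply. Qed.

Lemma out_domainE (p : pred arc) :
  [set a | E1 a.1 /\ p a] = [set` [fset a in domain_arcs | p a]%fset].
Proof.
apply/seteqP; split=> a /=; rewrite !inE/= mem_domain_arcs.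
  by case=> Ea ->; rewrite mem_set.
by case/andP => /set_mem.
Qed.

Lemma sum_arcs (T : nmodType) (p : pred arc) (F : arc -> T) :
  \sum_(a \in [set a | E1 a.1 /\ p a]) F a =
  \sum_(a <- domain_arcs | p a) F a.
Proof.
by rewrite out_domainE -fsbig_seq ?fset_uniq// big_fset/=.
Qed.

Lemma sum_out (T : nmodType) (v : point) (F : arc -> T) :
  \sum_(a \in out E1 v) F a = \sum_(a <- domain_arcs | src a == v) F a.
Proof.
rewrite -sum_arcs; apply: eq_fsbigl.
by apply/seteqP; split=> a /= [Ea /eqP av]; split=> //; apply/eqP.
Qed.

Lemma deg_sum S (v : point) : vertex G v ->
  deg S v = \sum_(a \in out (G:=G) S v) 1%N.
Proof.
move=> vv; rewrite fsbig_finite ?sum1_size//; exact: finite_out.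
Qed.

Lemma deg_domain (v : point) : V1 v ->
  deg E1 v = \sum_(a <- domain_arcs | src a == v) 1%N.
Proof. by move=> /V1_vertex vv; rewrite deg_sum// sum_out. Qed.

(** Translating each representative so that its source falls in the unit cell is a bijection onto
    the arcs of Gamma leaving u. *)
Lemma deg_orbit (u : point) : VF G u ->
  deg (G:=G) setT u = \sum_(a <- domain_arcs | frac G (src a) == u) 1%N.
Proof.
move=> uV; have [uv u0] := (VFP u).1 uV.
rewrite deg_sum// -sum_arcs.
apply: (@reindex_fsbig _ _ _ _ _ (fun a => otrans (- cell G (src a)) a)).
split.
- move=> a [_ /eqP au]; split=> //.
  by rewrite src_otrans -fracE.
- move=> a b; rewrite !inE => -[aE _] [bE _] ab.
  have abE : otrans (cell G (src b) - cell G (src a)) a = b.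
    by rewrite otransD ab -otransD subrr otrans0.
  by rewrite -{}abE in bE *; apply/esym/domain_arcs_otrans;
    rewrite mem_domain_arcs inE.
- move=> a [_ au]; have [m [b [bA abE]]] := domain_arcs_cover a.
  exists b; rewrite mem_domain_arcs inE in bA.
    split=> //; apply/eqP.
    by rewrite -(frac_VF uV) -au abE src_otrans frac_vtrans.
  rewrite abE; congr otrans.
  by have := u0; rewrite -au abE src_otrans cell_vtrans => /eqP;
    rewrite addr_eq0 => /eqP ->; rewrite opprK.
Qed.

(** Passing to the orbit is a bijection on representatives, and the index is constant on orbits. *)
Lemma sum_AF (T : nmodType) (u w : point) (F : Zd -> T) :
  \sum_(O \in AF (G:=G) u w) F (orbit_index O) =
  \sum_(a <- domain_arcs | (frac G (src a) == u) && (frac G (tgt a) == w))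
    F (edge_index a).
Proof.
rewrite -sum_arcs (@reindex_fsbig _ _ _ _ _ (fun a : arc => orbit_of a)
    [set a | E1 a.1 /\ (frac G (src a) == u) && (frac G (tgt a) == w)]).
  by apply: eq_fsbigr => a _; rewrite orbit_index_of.
split.
- by move=> a [_ /andP[/eqP au /eqP aw]]; exists a.
- move=> a b; rewrite !inE => -[aE _] [bE _] ab.
  have [m _ mb] : orbit_of a b by rewrite ab; exists 0 => //; exact: otrans0.
  by rewrite -{}mb in bE *; apply/esym/domain_arcs_otrans;
    rewrite mem_domain_arcs inE.
- move=> _ [a [-> au aw]]; have [m [b [bA abE]]] := domain_arcs_cover a.
  exists b; last by rewrite abE orbit_of_otrans.
  rewrite mem_domain_arcs inE in bA; split=> //.
  by rewrite -au -aw abE src_otrans tgt_otrans !frac_vtrans !eqxx.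
Qed.

(* All edges of Gamma at v are in E1, so an edge of E1 at a translate w <> v
   (one exists since E1 connects w to v) would be equivalent to one of them. *)
Lemma inner_orbit (v w : point) :
  inner V1 E1 v -> V1 w -> frac G w = frac G v -> w = v.
Proof.
move=> [V1v dv] V1w wv; apply: contrapT => wNv.
have vv := V1_vertex V1v.
have subout : (fset_set (out E1 v) `<=` fset_set (out setT v))%fset.
  rewrite -fset_set_sub; [|exact: finite_out..].
  by move=> a [_ av].
have outE : fset_set (out setT v) = fset_set (out E1 v).
  apply/esym/eqP; rewrite eqEfcard subout/=.
  by move: dv; rewrite /deg => ->.
have [] : exists p, walk E1 w p v.
  by case: hdom => _ [_ _ + _] _ _ _; apply.
(* The empty walk would give w = v; otherwise its first arc is translated back to v. *)
case=> [/=//|a p [Ea aw _]].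
have [m wE] : exists m, w = vtrans G m v.
  exists (cell G w - cell G v).
  by rewrite -{1}(vtrans_frac w) wv fracE -vtransD.
have : otrans (- m) a \in fset_set (out setT v).
  rewrite in_fset_set ?inE; last exact: finite_out.
  by split=> //; rewrite src_otrans aw wE vtransK.
rewrite outE in_fset_set ?inE; last exact: finite_out.
move=> -[Ema av]; apply: wNv.
by rewrite -av domain_arcs_otrans// mem_domain_arcs inE.
Qed.

(** The translate of v in the unit cell lies in V_F, hence in V_1, and so coincides with v by
    [inner_orbit]. *)
Lemma inner_VF (v : point) : inner V1 E1 v -> VF G v.
Proof.
move=> vi; have V1v : V1 v by case: vi.
have fV := VF_frac (V1_vertex V1v).
have V1f : V1 (frac G v) by case: hdom => _ [_ _ _ +] _ _ _; apply.
by rewrite -(inner_orbit vi V1f _)// (frac_VF fV).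
Qed.

Lemma finite_V1 : finite_set V1.
Proof. by case: hdom => _ [+ _ _ _] _ _ _. Qed.

Lemma VF_V1 : VF G `<=` V1.
Proof. by case: hdom => _ [_ _ _ +] _ _ _. Qed.

Lemma finite_VF : finite_set (VF G).
Proof. exact: sub_finite_set VF_V1 finite_V1. Qed.

Variable Q : point -> R.
Hypothesis hQ : is_periodic_potential G Q.

(** Periodicity is assumed for the generators a_s only; it extends to their inverses, their
    multiples, and finally sums of these. *)
Lemma potential_vtrans m (v : point) : vertex G v -> Q (vtrans G m v) = Q v.
Proof.
pose e s : Zd := delta_mx 0 s.
have lattice_e s : lattice_vec G (e s) = row s (basis G).
  by rewrite /lattice_vec /e map_delta_mx -rowE.
have step s x : vertex G x -> Q (vtrans G (e s) x) = Q x.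
  by move=> vx; rewrite /vtrans lattice_e hQ.
have stepN s x : vertex G x -> Q (vtrans G (- e s) x) = Q x.
  move=> vx; rewrite -(step s (vtrans G (- e s) x)); last exact: vertex_vtrans.
  by rewrite -vtransD subrr vtrans0.
have stepn s (k : int) x : vertex G x -> Q (vtrans G (e s *~ k) x) = Q x.
  elim/int_ind: k x => [x|n IH x vx|n IH x vx]; first by rewrite mulr0z vtrans0.
    rewrite intS mulrzDr mulr1z vtransD step ?IH//; exact: vertex_vtrans.
  rewrite intS opprD mulrzDr mulrNz mulr1z vtransD stepN ?IH//.
  exact: vertex_vtrans.
move: v; rewrite (row_sum_delta m) => v vv.
elim/big_rec: _ v vv => [v|s m' _ IH v vv]; first by rewrite vtrans0.
rewrite vtransD (_ : _ *: _ = e s *~ m 0 s); last first.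
  by rewrite -scaler_int intz.
by rewrite stepn ?IH//; exact: vertex_vtrans.
Qed.

Lemma potential_frac (v : point) : vertex G v -> Q (frac G v) = Q v.
Proof. by move=> vv; rewrite fracE potential_vtrans. Qed.

End Combinatorics.

(** * Factorization of the operators over the edges of the domain *)

Section Points.
Variables (R : realType) (d : nat).
Local Notation point := 'rV[R]_d.
Local Notation C := R[i].

Lemma sum_nth_pt (A : set point) (F : point -> C) :
  \sum_(i < size_of A) F (nth_pt i) = \sum_(x <- fset_set A) F x.
Proof. by rewrite (big_nth 0) big_mkord. Qed.

Lemma nth_ptP (A : set point) (i : 'I_(size_of A)) :
  finite_set A -> A (nth_pt i).
Proof. by move=> fA; apply/set_mem; rewrite -in_fset_set// mem_nth. Qed.

Lemma nth_pt_eq (A : set point) (i j : 'I_(size_of A)) :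
  (nth_pt i == nth_pt j) = (i == j).
Proof. by rewrite nth_uniq// fset_uniq. Qed.

Lemma sum_pt (A : set point) (F : point -> C) (x : point) :
  finite_set A -> A x ->
  (forall y, A y -> y != x -> F y = 0) ->
  \sum_(i < size_of A) F (nth_pt i) = F x.
Proof.
move=> fA Ax F0; rewrite sum_nth_pt (bigD1_seq x)/= ?fset_uniq//; last first.
  by rewrite in_fset_set// mem_set.
rewrite big_seq_cond big1 ?addr0// => y /andP[].
by rewrite in_fset_set// => /set_mem; exact: F0.
Qed.

(** Restriction of functions from B to A; for A inside B the adjoint is extension by zero. *)
Definition selection (A B : set point) : 'M[C]_(size_of A, size_of B) :=
  \matrix_(i, j) (nth_pt i == nth_pt j)%:R.

Lemma mul_selection (A B : set point) n (f : point -> 'I_n -> C) :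
  finite_set B -> A `<=` B ->
  selection A B *m \matrix_(j, k) f (nth_pt j) k =
  \matrix_(i, k) f (nth_pt i) k.
Proof.
move=> fB AB; have fA := sub_finite_set AB fB.
apply/matrixP => i k; rewrite !mxE.
under eq_bigr do rewrite !mxE.
rewrite (sum_pt (F := fun y => (nth_pt i == y)%:R * f y k) (x := nth_pt i))//.
- by rewrite eqxx mul1r.
- by apply: AB; exact: (nth_ptP i fA).
- by move=> y _; rewrite eq_sym => /negPf ->; rewrite mul0r.
Qed.

Lemma mul_selection_tr (A B : set point) n (f : 'I_n -> point -> C) :
  finite_set B -> A `<=` B ->
  (\matrix_(k, j) f k (nth_pt j)) *m (selection A B)^t* =
  \matrix_(k, i) f k (nth_pt i).
Proof.
move=> fB AB; apply: trmx_inj; rewrite trmx_mul.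
have -> : ((selection A B)^t*)^T = selection A B.
  by apply/matrixP => i j; rewrite !mxE conjC_nat.
have trE m (g : 'I_n -> 'I_m -> C) :
      (\matrix_(k, j) g k j)^T = \matrix_(j, k) g k j.
  by apply/matrixP => i j; rewrite !mxE.
by rewrite !trE (mul_selection (fun x k => f k x)).
Qed.

Lemma selection_unitary (A B : set point) : finite_set B -> A `<=` B ->
  selection A B \is unitarymx.
Proof.
move=> fB AB; apply/unitarymxP; rewrite {1}/selection.
rewrite (mul_selection_tr (fun k y => (nth_pt k == y)%:R))//.
by apply/matrixP => i j; rewrite !mxE nth_pt_eq.
Qed.

Lemma compression_sub (T : (point -> C) -> point -> C) (A B : set point) :
  finite_set B -> A `<=` B ->
  compression T A = selection A B *m compression T B *m (selection A B)^t*.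
Proof.
move=> fB AB; rewrite /compression.
rewrite (mul_selection (fun x k => T (fun y => (y == nth_pt k)%:R) x))//.
by rewrite (mul_selection_tr (fun k y => T (fun z => (z == y)%:R) (nth_pt k))).
Qed.

Lemma map_nth_pt (A : set point) :
  [seq nth_pt i | i <- enum 'I_(size_of A)] = fset_set A.
Proof.
by rewrite -[RHS](mkseq_nth 0) /mkseq -val_enum_ord -map_comp.
Qed.

Lemma cisD (x y : R) : cis (x + y) = cis x * cis y.
Proof.
rewrite /cis cosD sinD; apply/eqP.
by rewrite eq_complex/= eqxx addrC mulrC/=.
Qed.

Lemma cis0 : cis 0 = 1 :> C.
Proof. by rewrite /cis cos0 sin0. Qed.

Lemma conj_cis (x : R) : (cis x)^* = cis (- x).
Proof. by rewrite /cis cosN sinN. Qed.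

Lemma dotZB (m m' : 'rV[int]_d) (theta : point) :
  dotZ (m - m') theta = dotZ m theta - dotZ m' theta.
Proof.
by rewrite /dotZ -sumrB; apply: eq_bigr => s _; rewrite !mxE rmorphB/= mulrBl.
Qed.

Lemma dotZ0 (theta : point) : dotZ 0 theta = 0.
Proof. by rewrite /dotZ big1// => s _; rewrite mxE mul0r. Qed.

End Points.

(** * The isometry between quotient and domain, and the resulting compressions *)

Section Embedding.
Variables (R : realType) (d : nat) (G : graph R d).
Hypothesis hG : is_periodic G.
Variables (V1 : set 'rV[R]_d) (E1 : set (edge G)).
Hypothesis hdom : is_fundamental_domain V1 E1.
Variable theta : 'rV[R]_d.
Local Notation point := 'rV[R]_d.
Local Notation arc := (edge G * bool)%type.
Local Notation C := R[i].
Local Notation frac := Defs.frac.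
Local Notation cell := Defs.cell.

Definition reverse (a : arc) : arc := (a.1, ~~ a.2).

Lemma reverseK : involutive reverse.
Proof. by case=> e b; rewrite /reverse negbK. Qed.

Lemma src_reverse a : src (reverse a) = tgt a.
Proof. by case: a => e []. Qed.

Lemma domain_arcs_reverse a :
  (reverse a \in domain_arcs E1) = (a \in domain_arcs E1).
Proof. by rewrite !(mem_domain_arcs hdom). Qed.

Lemma sum_reverse (T : nmodType) (F : arc -> T) :
  \sum_(a <- domain_arcs E1) F (reverse a) = \sum_(a <- domain_arcs E1) F a.
Proof.
rewrite -[LHS](big_map reverse xpredT F); apply: perm_big; apply: uniq_perm.
- by rewrite map_inj_uniq ?fset_uniq//; exact: inv_inj reverseK.
- exact: fset_uniq.
- move=> a; rewrite -{1}(reverseK a) mem_map; last exact: inv_inj reverseK.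
  exact: domain_arcs_reverse.
Qed.

Definition arc_at (k : 'I_(size (domain_arcs E1))) : arc :=
  tnth (in_tuple (domain_arcs E1)) k.

Lemma sum_arc_at (T : nmodType) (F : arc -> T) :
  \sum_(k < size (domain_arcs E1)) F (arc_at k) =
  \sum_(a <- domain_arcs E1) F a.
Proof. by rewrite [RHS]big_tnth. Qed.

Lemma arc_atP k : arc_at k \in domain_arcs E1.
Proof. exact: mem_tnth. Qed.

Local Notation rdeg S v := (Num.sqrt ((deg (G:=G) S v)%:R : R)).

Definition phase (v : point) : C := cis (- dotZ (cell G v) theta).

(* The (u, v) entry of P, conjugate to the (v, u) entry of the quasi-periodic
   extension P^* : hence the minus sign in phase. *)
Definition embed (u v : point) : C :=
  if frac G v == u then (rdeg E1 v / rdeg setT u)%:C%C * phase v else 0.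

(** Normalized incidence: the Neumann Laplacian is - S1 T1^*, where [T1] is [S1] read on reversed
    arcs. *)
Definition domain_src (v : point) (a : arc) : C :=
  if src a == v then (rdeg E1 v)^-1%:C%C else 0.

(** The image of [domain_src] under P: normalized by the degree in Gamma and twisted by the phase of
    the source. *)
Definition quotient_src (u : point) (a : arc) : C :=
  if frac G (src a) == u then (rdeg setT u)^-1%:C%C * phase (src a) else 0.

Definition embed_mx : 'M[C]_(size_of (VF G), size_of V1) :=
  \matrix_(i, j) embed (nth_pt i) (nth_pt j).

Definition arc_mx (A : set point) (f : point -> arc -> C) :
    'M[C]_(size_of A, size (domain_arcs E1)) :=
  \matrix_(i, k) f (nth_pt i) (arc_at k).

Local Notation S1 := (arc_mx V1 domain_src).
Local Notation T1 := (arc_mx V1 (fun v a => domain_src v (reverse a))).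
Local Notation S := (arc_mx (VF G) quotient_src).
Local Notation T := (arc_mx (VF G) (fun v a => quotient_src v (reverse a))).

Lemma arc_mxM (A : set point) (f g : point -> arc -> C) :
  arc_mx A f *m (arc_mx A g)^t* =
  \matrix_(i, j) \sum_(a <- domain_arcs E1) f (nth_pt i) a * (g (nth_pt j) a)^*.
Proof.
apply/matrixP => i j; rewrite !mxE.
rewrite -(sum_arc_at (fun a => f (nth_pt i) a * (g (nth_pt j) a)^*)).
by apply: eq_bigr => k _; rewrite !mxE.
Qed.

(** Summing over reversed arcs swaps the factors. Hermitian symmetry and the commutation required by
    [qform_unitary_mul] both come from this. *)
Lemma arc_mx_reverse (A : set point) (f : point -> arc -> C) :
  arc_mx A (fun v a => f v (reverse a)) *m (arc_mx A f)^t* =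
  arc_mx A f *m (arc_mx A (fun v a => f v (reverse a)))^t*.
Proof.
rewrite !arc_mxM; apply/matrixP => i j; rewrite !mxE -sum_reverse.
by apply: eq_bigr => a _; rewrite reverseK.
Qed.

Lemma arc_mx_reverse_sqr (A : set point) (f : point -> arc -> C) :
  arc_mx A (fun v a => f v (reverse a)) *m
    (arc_mx A (fun v a => f v (reverse a)))^t* =
  arc_mx A f *m (arc_mx A f)^t*.
Proof.
rewrite !arc_mxM; apply/matrixP => i j; rewrite !mxE.
by rewrite (sum_reverse (fun a => f (nth_pt i) a * (f (nth_pt j) a)^*)).
Qed.

Lemma rdeg_gt0 (v : point) : vertex G v -> 0 < rdeg setT v.
Proof. by move=> vv; rewrite sqrtr_gt0 ltr0n deg_vertex_gt0. Qed.

Lemma rdeg_src_gt0 (a : arc) : a \in domain_arcs E1 -> 0 < rdeg E1 (src a).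
Proof.
rewrite (mem_domain_arcs hdom) inE => Ea; rewrite sqrtr_gt0 ltr0n.
by apply/deg_gt0; [|exact: vertex_src|exists a].
Qed.

Lemma VF_vertex (u : point) : VF G u -> vertex G u.
Proof. by case. Qed.

(** Only v = src (g a) contributes, and its factor sqrt(deg_1 v) cancels, being nonzero because g a
    leaves v. The maps used are the identity, for [S], and [reverse], for [T]. *)
Lemma embed_arc_mx (g : arc -> arc) :
  {homo g : a / a \in domain_arcs E1} ->
  embed_mx *m arc_mx V1 (fun v a => domain_src v (g a)) =
  arc_mx (VF G) (fun u a => quotient_src u (g a)).
Proof.
move=> gD; apply/matrixP => i k; rewrite !mxE.
under eq_bigr do rewrite !mxE.
set a := g _; set u := nth_pt i.
have aD : a \in domain_arcs E1 by exact/gD/arc_atP.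
rewrite (sum_pt (F := fun v => embed u v * domain_src v a) (x := src a)).
- rewrite /embed /domain_src /quotient_src eqxx.
  case: eqP => _; last by rewrite mul0r.
  rewrite mulrAC -rmorphM/=; congr (_%:C%C * _).
  by rewrite mulrAC mulfV ?mul1r// gt_eqF// rdeg_src_gt0.
- exact: finite_V1 hdom.
- exact: V1_src aD.
- by move=> v _ va; rewrite /domain_src eq_sym (negPf va) mulr0.
Qed.

Lemma embed_arc_mx_id : embed_mx *m S1 = S.
Proof. exact: (@embed_arc_mx id). Qed.

Lemma phaseJ (v : point) : phase v * (phase v)^* = 1.
Proof. by rewrite conj_cis -cisD subrr cis0. Qed.

Lemma conjC_real (x : R) : (x%:C%C)^* = x%:C%C :> C.
Proof. by apply/eqP; rewrite eq_complex/= oppr0 !eqxx. Qed.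

Lemma conjC_realM (x : R) (z : C) : (x%:C%C * z)^* = x%:C%C * z^*.
Proof. by rewrite rmorphM; congr (_ * _); exact: conjC_real. Qed.

(** Double counting: each domain arc with source equivalent to u is counted at exactly one vertex of
    V_1. *)
Lemma sum_deg_orbit (u : point) : VF G u ->
  (\sum_(v <- fset_set V1 | frac G v == u) deg E1 v)%N = deg (G:=G) setT u.
Proof.
move=> uV; rewrite (deg_orbit hG hdom uV).
transitivity (\sum_(v <- fset_set V1 | frac G v == u)
    \sum_(a <- domain_arcs E1 | src a == v) 1%N).
  rewrite big_seq_cond [RHS]big_seq_cond; apply: eq_bigr => v /andP[+ _].
  rewrite in_fset_set; last exact: finite_V1 hdom.
  by rewrite inE => /(deg_domain hG hdom).
rewrite (exchange_big_dep (fun a => frac G (src a) == u))/=; last first.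
  by move=> v a /eqP vu /eqP ->; rewrite vu.
rewrite big_seq_cond [RHS]big_seq_cond; apply: eq_bigr => a /andP[aD /eqP au].
have aV : src a \in fset_set V1.
  by rewrite in_fset_set ?inE; [exact: V1_src aD|exact: finite_V1 hdom].
rewrite -big_filter (bigD1_seq (src a)) ?filter_uniq ?fset_uniq//=; last first.
  by rewrite mem_filter au !eqxx.
rewrite big_filter_cond big1 ?addn0// => v /andP[/andP[_ /eqP ->]].
by rewrite eqxx.
Qed.

(** Rows of P have disjoint supports; on the diagonal the phases have modulus 1 and the weights
    deg_1 v / deg u add up to 1. The case q = 1 gives P P^* = 1, the case q = Q transports the
    potential. *)
Lemma embed_diag (q : point -> C) : (forall v, V1 v -> q (frac G v) = q v) ->
  embed_mx *m diag_mx (\row_j q (nth_pt j)) *m embed_mx^t* =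
  diag_mx (\row_i q (nth_pt i)).
Proof.
move=> qfrac; apply/matrixP => i j; rewrite !mxE.
under eq_bigr do rewrite mul_mx_diag !mxE.
rewrite (sum_nth_pt _
  (fun v => embed (nth_pt i) v * q v * (embed (nth_pt j) v)^*)).
have [<-|ij] := eqVneq; last first.
  rewrite mulr0n big1// => v _; rewrite /embed; case: eqP => [->|]; last first.
    by rewrite !mul0r.
  by rewrite nth_pt_eq (negPf ij) rmorph0 mulr0.
rewrite mulr1n; set u := nth_pt i.
have uV : VF G u by apply: (nth_ptP i); exact: finite_VF hdom.
pose c : R := (deg (G:=G) setT u)%:R.
have c0 : 0 < c by rewrite ltr0n deg_vertex_gt0//; exact: VF_vertex.
rewrite big_seq (eq_bigr (fun v => if frac G v == u then
    ((deg E1 v)%:R / c)%:C%C * q u else 0)); last first.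
  move=> v; rewrite in_fset_set ?inE => [V1v|]; last exact: finite_V1 hdom.
  rewrite /embed; case: eqP => [vu|]; last by rewrite !mul0r.
  rewrite -(qfrac _ V1v) vu conjC_realM.
  rewrite mulrAC mulrACA phaseJ mulr1 -rmorphM/=; congr (_%:C%C * _).
  rewrite mulrACA -invfM -!expr2 !sqr_sqrtr ?ler0n//.
rewrite -big_seq -big_mkcond/= -mulr_suml -rmorph_sum/= -mulr_suml.
by rewrite -natr_sum sum_deg_orbit// divff ?mul1r// gt_eqF.
Qed.

Lemma embed_mx_unitary : embed_mx \is unitarymx.
Proof.
apply/unitarymxP; have := embed_diag (q := fun=> 1) (fun _ _ => erefl).
have one n : diag_mx (\row_(j < n) 1) = 1%:M :> 'M[C]_n.
  by rewrite -diag_const_mx; congr diag_mx; apply/rowP => j; rewrite !mxE.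
by rewrite !one mulmx1.
Qed.

(** The row of u has deg u nonzero entries, all of modulus (deg u)^(-1/2), and distinct rows have
    disjoint supports. *)
Lemma quotient_mx_unitary : S \is unitarymx.
Proof.
apply/unitarymxP; rewrite arc_mxM; apply/matrixP => i j; rewrite !mxE.
have [<-|ij] := eqVneq; last first.
  rewrite big1// => a _; rewrite /quotient_src; case: eqP => [->|]; last first.
    by rewrite !mul0r.
  by rewrite nth_pt_eq (negPf ij) rmorph0 mulr0.
set u := nth_pt i.
have uV : VF G u by apply: (nth_ptP i); exact: finite_VF hdom.
pose c : R := (deg (G:=G) setT u)%:R.
have c0 : 0 < c by rewrite ltr0n deg_vertex_gt0//; exact: VF_vertex.
rewrite (eq_bigr
  (fun a => if frac G (src a) == u then (c^-1)%:C%C * 1%:R else 0)).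
  rewrite -big_mkcond/= -mulr_sumr -natr_sum -(deg_orbit hG hdom uV).
  by rewrite -(rmorph_nat (real_complex R)) -rmorphM/= mulVf// gt_eqF.
move=> a _; rewrite /quotient_src; case: eqP => [vu|]; last by rewrite !mul0r.
rewrite conjC_realM mulrACA phaseJ -rmorphM/= !mulr1; congr (_%:C%C).
by rewrite -invfM -expr2 sqr_sqrtr ?ler0n.
Qed.

Variable Q : point -> R.

Lemma neumannE : neumann V1 E1 Q =
  diag_mx (\row_i (Q (nth_pt i))%:C%C) - S1 *m T1^t*.
Proof.
rewrite arc_mxM; apply/matrixP => i j; rewrite /neumann /compression !mxE.
rewrite /schroedinger nth_pt_eq addrC mulr_natr; congr (_ + _).
rewrite mulNr (sum_out hdom) mulr_sumr; congr (- _).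
rewrite big_mkcond; apply: eq_bigr => a _; rewrite /domain_src src_reverse.
case: (src a =P _) => [_|_]; last by rewrite mul0r.
case: (tgt a =P _) => [->|_]; last by rewrite conjC0 !mulr0.
by rewrite mulr1 conjC_real.
Qed.

Lemma floquetE : floquet G Q theta =
  diag_mx (\row_i (Q (nth_pt i))%:C%C) - S *m T^t*.
Proof.
rewrite arc_mxM; apply/matrixP => i j; rewrite !mxE addrC.
congr (_ + _); last by case: (i == j).
rewrite mulNr (sum_AF hG hdom _ _ (fun m => cis (dotZ m theta))) mulr_sumr.
congr (- _).
rewrite big_mkcond; apply: eq_bigr => a _; rewrite /quotient_src src_reverse.
case: (frac _ (src a) =P _) => _ /=; last by rewrite mul0r.
case: (frac _ (tgt a) =P _) => _; last by rewrite conjC0 mulr0.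
(* The phase of the source and the conjugate phase of the target combine into the exponential of the
   edge index. *)
rewrite conjC_realM mulrACA conj_cis opprK -cisD.
by rewrite addrC -dotZB sqrtrM ?ler0n// invfM rmorphM.
Qed.

Lemma neumann_herm : neumann V1 E1 Q \is hermsymmx.
Proof.
apply: hermsymmxP; rewrite neumannE linearB/= map_mxB hermitian_diag.
by rewrite trmx_mul map_mxM trmxCK arc_mx_reverse.
Qed.

Hypothesis hQ : is_periodic_potential G Q.

Lemma floquet_neumann :
  floquet G Q theta = embed_mx *m neumann V1 E1 Q *m embed_mx^t*.
Proof.
rewrite floquetE neumannE mulmxBr mulmxBl; congr (_ - _).
  rewrite (embed_diag (q := fun v => (Q v)%:C%C))// => v V1v.
  by rewrite (potential_frac hG hQ)//; exact: V1_vertex hdom _ V1v.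
rewrite -embed_arc_mx_id -(embed_arc_mx (g := reverse)); last first.
  by move=> a; rewrite domain_arcs_reverse.
by rewrite trmx_mul map_mxM !mulmxA.
Qed.

Lemma floquet_herm : floquet G Q theta \is hermsymmx.
Proof. by rewrite floquet_neumann; exact/herm_compression/neumann_herm. Qed.

Lemma arc_mx_reverse_unitary : T \is unitarymx.
Proof.
apply/unitarymxP; rewrite arc_mx_reverse_sqr.
exact/unitarymxP/quotient_mx_unitary.
Qed.

Lemma laplacian_bound (x : 'rV[C]_(size_of (VF G))) :
  - qform 1%:M x <= qform (S *m T^t*) x <= qform 1%:M x.
Proof.
apply: qform_unitary_mul; last exact: arc_mx_reverse.
  exact: quotient_mx_unitary.
exact: arc_mx_reverse_unitary.
Qed.

Lemma inner_sub_VF : inner V1 E1 `<=` VF G.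
Proof. by move=> v; exact: inner_VF. Qed.

(** At an inner vertex u the phase is 1 and the two degrees agree, so P has entry 1 at (u, u); no
    other point of V_1 is equivalent to u. *)
Lemma selection_embed :
  selection (inner V1 E1) (VF G) *m embed_mx = selection (inner V1 E1) V1.
Proof.
have fVF := finite_VF hdom; have fV1 := finite_V1 hdom.
have fi := sub_finite_set inner_sub_VF fVF.
rewrite (mul_selection (fun u k => embed u (nth_pt k)))//;
  last exact: inner_sub_VF.
apply/matrixP => i k; rewrite !mxE /embed.
set u := nth_pt i; set v := nth_pt k.
have ui : inner V1 E1 u := nth_ptP i fi.
have uV := inner_sub_VF ui; have V1v : V1 v := nth_ptP k fV1.
have [uv|uv] := eqVneq u v.
  rewrite -uv (frac_VF uV) eqxx /phase ((VFP G u).1 uV).2.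
  rewrite dotZ0 oppr0 cis0 mulr1.
  by rewrite -ui.2 divff// gt_eqF// rdeg_gt0//; exact: VF_vertex.
case: eqP => // vu; case/eqP: uv; apply/esym/(inner_orbit hG hdom ui V1v).
by rewrite vu (frac_VF uV).
Qed.

(** Restriction from V_1 to the inner vertices factors through P, so H_o is a compression of
    H(theta) for every theta. *)
Lemma dirichlet_floquet : dirichlet V1 E1 Q =
  selection (inner V1 E1) (VF G) *m floquet G Q theta
    *m (selection (inner V1 E1) (VF G))^t*.
Proof.
rewrite /dirichlet (compression_sub _ (finite_V1 hdom)); last by move=> v [].
by rewrite -selection_embed floquet_neumann trmx_mul map_mxM !mulmxA.
Qed.

Lemma eigenvalues_potential :
  eigenvalues (diag_mx (\row_(i < size_of (VF G)) (Q (nth_pt i))%:C%C)) =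
  sorted_values Q (VF G).
Proof. by rewrite eigenvalues_diag /sorted_values -map_nth_pt -map_comp. Qed.

Lemma diag_herm n (q : 'I_n -> R) : diag_mx (\row_i (q i)%:C%C) \is hermsymmx.
Proof. exact/hermsymmxP/hermitian_diag. Qed.

(** The forms of H(theta) and Q differ by at most the squared norm, so [eig_le_qform] applies with c
    = 1, once in each direction. *)
Lemma floquet_potential_bound n : (0 < n <= size_of (VF G))%N ->
  nth1 (sorted_values Q (VF G)) n - 1 <= eig (floquet G Q theta) n
    <= nth1 (sorted_values Q (VF G)) n + 1.
Proof.
move=> hn; rewrite -eigenvalues_potential -/(eig _ _).
set D := diag_mx _; have Dh : D \is hermsymmx by exact: diag_herm.
have HD x : qform (floquet G Q theta) x = qform D x - qform (S *m T^t*) x.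
  by rewrite floquetE -scaleN1r qformD qformZ mulN1r.
apply/andP; split.
- rewrite lerBlDr; apply: (eig_le_qform Dh floquet_herm _ hn) => x.
  rewrite HD rmorph1 mul1r -addrA lerDl addrC subr_ge0.
  by have /andP[] := laplacian_bound x.
- apply: (eig_le_qform floquet_herm Dh _ hn) => x.
  rewrite HD rmorph1 mul1r lerD2l lerNl.
  by have /andP[] := laplacian_bound x.
Qed.

End Embedding.

(** * Localization of the bands *)

Theorem theorem2p1 (R : realType) (d : nat) (hd : (2 <= d)%N)
  (G : graph R d) (hG : is_periodic G)
  (V1 : set 'rV[R]_d) (E1 : set (edge G))
  (hdom : is_fundamental_domain V1 E1)
  (Q : 'rV[R]_d -> R) (hQ : is_periodic_potential G Q)
  (n : nat) (hn : (1 <= n <= size_of (VF G))%N) :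
  band G Q n `<=` intervalJ V1 E1 Q n `&` intervalK V1 E1 Q n.
Proof.
move=> _ [theta _ <-].
(* Compressing H_1 to H(theta) yields the lambda^1 endpoints in all cases. *)
have /andP[lo1 up1] := cauchy_interlacing (neumann_herm hdom Q)
  (embed_mx_unitary hG hdom theta) hn.
have /andP[loq upq] := floquet_potential_bound hG hdom theta hQ hn.
rewrite -floquet_neumann// in lo1 up1.
have selu := selection_unitary (finite_VF hdom) (inner_sub_VF hG hdom).
have sel_le : (size_of (inner V1 E1) <= size_of (VF G))%N.
  by rewrite -(mxrank_unitary selu) rank_leq_col.
have dirE := dirichlet_floquet hG hdom theta hQ.
have dir k := cauchy_interlacing (k := k) (floquet_herm hG hdom theta hQ) selu.
rewrite -dirE in dir.
move/andP: hn => [n1 nnu].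
split; rewrite /intervalJ /intervalK; case: leqP => nle /=; rewrite in_itv/=.
- by rewrite lo1; have /andP[-> _] := dir n ltac:(lia).
- by rewrite lo1.
- by rewrite loq.
- rewrite up1 andbT.
  (* Interlacing is used at k = n + nu_o - nu, which is positive as n > nu - nu_o; its upper index k
     + nu - nu_o is then n. *)
  have kn : (n + size_of (inner V1 E1) - size_of (VF G) + size_of (VF G)
    - size_of (inner V1 E1) = n)%N by lia.
  have /andP[_] :=
    dir (n + size_of (inner V1 E1) - size_of (VF G))%N ltac:(lia).
  by rewrite kn.
Qed.
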